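(* Let $\alpha,\beta,\gamma$ be integers with $1\le\alpha\le\beta\le\gamma$ and $\beta\ge 2$. Then the theta graph $\Theta(\alpha,\beta,\gamma)$ is of QE class if and only if either (1) $\alpha=1$, or (2) $\alpha=2$, $\beta=3$ and $\gamma\in\{3,5,7\}$.
   Context: Graphs are simple and undirected. For a connected graph $G=(V,E)$, $d(x,y)=d_G(x,y)$ denotes the graph distance between $x,y\in V$, i.e. the length (number of edges) of a shortest walk connecting $x$ and $y$. A quadratic embedding of $G$ in a Hilbert space $\mathcal{H}$ is a map $\phi:V\to\mathcal{H}$ such that $\|\phi(x)-\phi(y)\|^2=d(x,y)$ for all $x,y\in V$, where $\|\cdot\|$ is the norm of $\mathcal{H}$. The graph $G$ is said to be of QE class if it admits a quadratic embedding in some Hilbert space; otherwise it is of non-QE class. Theta graphs: let $\alpha,\beta,\gamma\ge 1$ be integers, at most one of them equal to $1$. Let $P_{n+1}=[x_0,\dots,x_n]$ denote the path graph with $n+1$ vertices $x_0,\dots,x_n$ and $n$ edges $\{x_{i-1},x_i\}$, $i=1,\dots,n$. The theta graph $\Theta(\alpha,\beta,\gamma)$ is obtained by taking three path graphs $P_{\alpha+1}=[x_0,\dots,x_\alpha]$, $P_{\beta+1}=[y_0,\dots,y_\beta]$, $P_{\gamma+1}=[z_0,\dots,z_\gamma]$ with the same endpoints $x_0=y_0=z_0$ and $x_\alpha=y_\beta=z_\gamma$, the remaining vertices $x_j$ ($1\le j\le\alpha-1$), $y_j$ ($1\le j\le\beta-1$), $z_j$ ($1\le j\le\gamma-1$)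 being mutually different (and different from the two common endpoints, which are distinct). *)

(* Defs.v *)
From HB Require Import structures.
From mathcomp Require Import all_boot all_order all_algebra.
From mathcomp Require Import all_classical all_reals all_analysis.

Set Implicit Arguments.
Unset Strict Implicit.
Unset Printing Implicit Defensive.

Import Order.TTheory GRing.Theory Num.Theory.

(* Real Hilbert spaces: a complex one, with the real part of its inner product,
   is a real one with the same norm. *)
Record hilbertType (R : realType) := Hilbert {
  hilbert_sort :> completeNormedModType R;
  inner : ({dot hilbert_sort for idfun})%R;
  sqr_normE : forall v : hilbert_sort, (`|v| ^+ 2 = inner v v)%R
}.

Record sgraph := SGraph {
  vertex :> Type;
  adj : rel vertex;
  adj_sym : symmetric adj;
  adj_irrefl : irreflexive adj
}.

Definition has_walk (G : sgraph) (x y : G) (n : nat) : bool :=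
  `[< exists p : seq G, [/\ path (@adj G) x p, last x p = y & size p = n] >].

Definition connected_graph (G : sgraph) : Prop :=
  forall x y : G, exists n, has_walk x y n.

(* The value 0 for vertices not joined by a walk is a dummy, never used on
   connected graphs. *)
Definition gdist (G : sgraph) (x y : G) : nat :=
  match pselect (exists n, has_walk x y n) with
  | left w => ex_minn w
  | right _ => 0
  end.

Definition quadratic_embedding (R : realType) (G : sgraph) (H : hilbertType R)
    (phi : G -> H) : Prop :=
  forall x y : G, (`|phi x - phi y| ^+ 2 = (gdist x y)%:R)%R.

(* Meaningful for connected G only. *)
Definition QE_class (R : realType) (G : sgraph) : Prop :=
  exists (H : hilbertType R) (phi : G -> H), quadratic_embedding phi.

Section Theta.
Variables a b c : nat.

Definition theta_len : 'I_3 -> nat := tnth [tuple a; b; c].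

(* [inl false] and [inl true] are the common endpoints; [inr (Tagged _ i)] with
   [i : 'I_(theta_len k).-1] is the interior vertex number [i.+1] of path [k]. *)
Definition theta_vertex : finType :=
  (bool + {k : 'I_3 & 'I_(theta_len k).-1})%type.

(* Vertex number [j] of path [k], for [0 <= j <= theta_len k]. *)
Definition theta_pt (k : 'I_3) (j : nat) : theta_vertex :=
  if j == 0 then inl false
  else if (insub j.-1 : option 'I_(theta_len k).-1) is Some i
       then inr (Tagged (fun k' => 'I_(theta_len k').-1) i)
       else inl true.

Definition theta_adj : rel theta_vertex := fun u v =>
  [exists k : 'I_3, exists j : 'I_(theta_len k),
    ((u, v) == (theta_pt k j, theta_pt k j.+1)) ||
    ((v, u) == (theta_pt k j, theta_pt k j.+1))].

Lemma theta_adj_sym : symmetric theta_adj.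
Proof.
by move=> u v; apply: eq_existsb => k; apply: eq_existsb => j; rewrite orbC.
Qed.

Lemma theta_pt_neq (k : 'I_3) (j : 'I_(theta_len k)) :
  theta_pt k j != theta_pt k j.+1.
Proof.
case: j => -[|j] hj; rewrite /theta_pt /=; first by case: insubP.
have hj' : j < (theta_len k).-1 by rewrite -ltnS prednK // (leq_trans _ hj).
rewrite insubT; case: insubP => //= i _ ij; apply/eqP => -[] /eqP.
by rewrite eq_Tagged /= => /eqP e; move: ij; rewrite -e /= => /n_Sn.
Qed.

Lemma theta_adj_irrefl : irreflexive theta_adj.
Proof.
move=> u; apply/negbTE/negP => /existsP[k /existsP[j]].
rewrite orbb xpair_eqE => /andP[/eqP h1 /eqP h2].
by move: (theta_pt_neq j); rewrite -h1 -h2 eqxx.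
Qed.

Definition theta : sgraph := SGraph theta_adj_sym theta_adj_irrefl.

End Theta.

Lemma gdistP (G : sgraph) (x y : G) : connected_graph G ->
  has_walk x y (gdist x y) /\ forall n, has_walk x y n -> gdist x y <= n.
Proof.
move=> cG; rewrite /gdist; case: pselect => [w|]; last by move/(_ (cG x y)).
by case: ex_minnP => m hm mmin; split.
Qed.

Lemma has_walk_trans (G : sgraph) (x y z : G) m n :
  has_walk x y m -> has_walk y z n -> has_walk x z (m + n).
Proof.
move=> /asboolP[p [pp pl ps]] /asboolP[q [qp ql qs]]; apply/asboolP.
by exists (p ++ q); rewrite cat_path last_cat size_cat pp pl ps qs.
Qed.

Lemma has_walk_adj (G : sgraph) (x y : G) : adj x y -> has_walk x y 1.
Proof. by move=> xy; apply/asboolP; exists [:: y]; rewrite /= xy. Qed.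

Lemma theta_connected (a b c : nat) : 0 < a -> connected_graph (theta a b c).
Proof.
move=> a0; set G := theta a b c.
have adjS (k : 'I_3) j : j < theta_len a b c k ->
    @adj G (theta_pt a b c k j) (theta_pt a b c k j.+1).
  by move=> h; apply/existsP; exists k; apply/existsP; exists (Ordinal h);
    rewrite eqxx.
have from0 (k : 'I_3) j : j <= theta_len a b c k ->
    has_walk (inl false : G) (theta_pt a b c k j) j /\
    has_walk (theta_pt a b c k j : G) (inl false) j.
  elim: j => [|j IH] h; first by split; apply/asboolP; exists [::].
  have [h1 h2] := IH (ltnW h).
  split.
    by rewrite -[X in has_walk _ _ X]addn1; apply: has_walk_trans h1 (has_walk_adj (adjS _ _ h)).
  rewrite -[X in has_walk _ _ X]add1n; apply: has_walk_trans h2.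
  by apply: has_walk_adj; rewrite adj_sym; exact: adjS.
have onpath (u : G) : exists k j, j <= theta_len a b c k /\ u = theta_pt a b c k j.
  case: u => [[]|[k i]].
  - exists ord0, a; split; first by [].
    by case: a a0 @G adjS from0 => // n *; rewrite /theta_pt /= insubF //= ltnn.
  - by exists ord0, 0.
  - have hi := ltn_ord i; exists k, i.+1; split.
      by rewrite (leq_trans hi) ?leq_pred.
    by rewrite /theta_pt /= insubT /=; congr (inr (Tagged _ _)); apply: val_inj.
move=> x y.
have [k [j [jk ->]]] := onpath x; have [l [i [il ->]]] := onpath y.
exists (j + i); exact: has_walk_trans (from0 k j jk).2 (from0 l i il).1.
Qed.

(* Main.v *)
Require Import Defs.
From HB Require Import structures.
From mathcomp Require Import all_boot all_order all_algebra.
From mathcomp Require Import all_classical all_reals all_analysis.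
From mathcomp Require Import ring lra zify.

(** In an embedded theta graph the image of an edge, oriented from the first
    common endpoint to the second, is a unit vector, and by polarization twice
    the inner product of two edge vectors is the mixed second difference of the
    distance ([theta_gram]).  So the graph is of QE class exactly when this
    integer matrix is positive semidefinite, and everything is read off from the
    shape of the distance function.  Write a_i, b_j, c_k for the edge vectors of
    the three paths, with [alpha] the length of the shortest one.

    Along an isometric cycle of length n the distance is a tent min(s, n - s),
    which is linear except at its peak; hence two edges of the cycle have a
    nonzero inner product only if they are (nearly) opposite: in an even cycle
    opposite edges are parallel (inner product 1), in an odd cycle each edge
    has inner product 1/2, up to orientation, with the two edges at the opposite
    vertex.

    Necessity.  Let [alpha > 1].  If a_1 has a parallel edge in another
    path, that is if [alpha + beta] or [alpha + gamma] is even, then the two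
    parallel edges disagree on their inner products with the third path
    ([nonQE_even_even], [nonQE_even_odd]).  If both sums are odd, the edges in
    the middle of the second and third path are parallel to each other; for
    [alpha > 2] there are enough of them to disagree on a_1
    ([nonQE_odd_odd]).  This leaves alpha = 2, beta = 2p+1, gamma = 2q+1.  For
    p > 1 the vector b_(p+2) - b_p + c_(q+2) - c_q - (a_1 - a_2) has norm 0
    but is not orthogonal to b_1 ([nonQE_long_odd]); for p = 1 and q > 3 an
    explicit combination of edges has negative square norm ([nonQE_2_3]).

    Sufficiency.  It is enough to write a multiple of the distance as a
    nonnegative combination of squares (f x - f y)^2 ([QE_of_sum_squares]).
    If [alpha = 1] the graph is made of two cycles glued along an edge.  In a
    cycle twice the distance counts the cuts by arcs of half the length, and the
    two cuts through the common edge can be matched in the two cycles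
    ([QE_chord]).  The three sporadic graphs are given by explicit tables of
    squares ([QE_of_table]). *)

Set Implicit Arguments.
Unset Strict Implicit.
Unset Printing Implicit Defensive.

Import Order.TTheory GRing.Theory Num.Theory.
Import numFieldNormedType.Exports.

(** * Finite-dimensional Hilbert spaces *)

Section Euclid.
Local Open Scope ring_scope.
Local Open Scope classical_set_scope.

(** Row vectors already carry the sup norm; this alias is there to receive the
    Euclidean one. *)
Definition euclid (R : realType) (n : nat) : Type := 'rV[R]_n.
HB.instance Definition _ R n := GRing.Lmodule.copy (euclid R n) 'rV[R]_n.

Variables (R : realType) (n : nat).
Implicit Types u v w : euclid R n.

Definition dotp u v : R := \sum_i u 0 i * v 0 i.

Lemma dotpC u v : dotp u v = dotp v u.
Proof. by apply: eq_bigr => i _; rewrite mulrC. Qed.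

Lemma dotp_linear u : linear_for *%R (dotp u).
Proof.
move=> a v w; rewrite /dotp mulr_sumr -big_split /=.
by apply: eq_bigr => i _; rewrite !mxE mulrDr mulrCA.
Qed.

Lemma dotp_bilinear : bilinear_for *%R *%R dotp.
Proof.
split=> u; last exact: dotp_linear.
by move=> a v w; rewrite !(dotpC _ u) dotp_linear.
Qed.

Lemma dotpp_ge0 u : 0 <= dotp u u.
Proof. by apply: sumr_ge0 => i _; rewrite -expr2 sqr_ge0. Qed.

Lemma dotpp_eq0 u : dotp u u = 0 -> u = 0.
Proof.
move=> /eqP; rewrite psumr_eq0 => [|i _]; last by rewrite -expr2 sqr_ge0.
move=> /allP u0; apply/rowP => i; rewrite mxE; apply/eqP.
by have := u0 i (mem_index_enum i); rewrite mulf_eq0 orbb.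
Qed.

HB.instance Definition _ := bilinear_isBilinear.Build R
  (euclid R n) (euclid R n) R *%R *%R dotp dotp_bilinear.

Lemma dotp_herm u v : dotp u v = (-1) ^+ false * idfun (dotp v u).
Proof. by rewrite expr0 mul1r dotpC. Qed.

HB.instance Definition _ := isHermitianSesquilinear.Build R
  (euclid R n) false idfun dotp dotp_herm.

Lemma dotp_gt0 u : u != 0 -> 0 < dotp u u.
Proof.
move=> u0; rewrite lt_neqAle dotpp_ge0 andbT eq_sym.
by apply: contra u0 => /eqP /dotpp_eq0 ->.
Qed.

HB.instance Definition _ := isDotProduct.Build R (euclid R n) dotp dotp_gt0.

Definition enorm u := Num.sqrt (dotp u u).

Lemma dotpZr a u v : dotp u (a *: v) = a * dotp u v.
Proof. by rewrite linearZr. Qed.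

Lemma dotpDD u v : dotp (u + v) (u + v) = dotp u u + dotp v v + dotp u v *+ 2.
Proof. by rewrite linearDl !linearDr /= (dotpC v u) mulr2n; ring. Qed.

Lemma dotpZZ a u : dotp (a *: u) (a *: u) = a ^+ 2 * dotp u u.
Proof. by rewrite linearZl linearZr /= mulrA expr2. Qed.

Lemma sqr_enorm u : enorm u ^+ 2 = dotp u u.
Proof. by rewrite sqr_sqrtr ?dotpp_ge0. Qed.

Lemma cauchy_schwarz u v : dotp u v <= enorm u * enorm v.
Proof.
have [u0|u0] := eqVneq u 0.
  by rewrite u0 linear0l mulr_ge0 ?sqrtr_ge0.
have [v0|v0] := eqVneq v 0.
  by rewrite v0 linear0r mulr_ge0 ?sqrtr_ge0.
have ab : 0 < enorm u * enorm v by rewrite mulr_gt0 ?sqrtr_gt0 ?dotp_gt0.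
(* This vector vanishes exactly in the case of equality. *)
have := dotpp_ge0 (enorm v *: u + (- enorm u) *: v).
rewrite dotpDD !dotpZZ -!sqr_enorm dotpZr dotpC dotpZr (dotpC v) => h.
rewrite -(ler_pM2l ab); nra.
Qed.

Fact enorm_triangle u v : enorm (u + v) <= enorm u + enorm v.
Proof.
rewrite -ler_sqr ?nnegrE ?addr_ge0 ?sqrtr_ge0 // sqr_enorm dotpDD sqrrD.
by rewrite !sqr_enorm; have := cauchy_schwarz u v; lra.
Qed.

Fact enormZ a u : enorm (a *: u) = `|a| * enorm u.
Proof. by rewrite /enorm dotpZZ sqrtrM ?sqr_ge0 // sqrtr_sqr. Qed.

Fact enorm_eq0 u : enorm u = 0 -> u = 0.
Proof. by move=> u0; apply: dotpp_eq0; rewrite -sqr_enorm u0 expr0n. Qed.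

HB.instance Definition _ :=
  Lmodule_isNormed.Build R (euclid R n) enorm_triangle enormZ enorm_eq0.

Lemma sqr_euclid_normE v : `|v| ^+ 2 = dotp v v.
Proof. exact: sqr_enorm. Qed.

Lemma coord_le_norm v i : `|v 0 i| <= `|v|.
Proof.
rewrite -ler_sqr ?nnegrE // sqr_euclid_normE real_normK ?num_real //.
rewrite /dotp (bigD1 i) //= -expr2 lerDl.
by apply: sumr_ge0 => j _; rewrite -expr2 sqr_ge0.
Qed.

Lemma norm_le_sum v : `|v| <= \sum_i `|v 0 i|.
Proof.
have h0 : 0 <= \sum_i `|v 0 i| by apply: sumr_ge0.
rewrite -ler_sqr ?nnegrE // sqr_euclid_normE.
rewrite expr2 mulr_suml; apply: ler_sum => i _.
rewrite -expr2 -real_normK ?num_real // expr2 ler_wpM2l //.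
by rewrite (bigD1 i) //= lerDl sumr_ge0.
Qed.

(** The limit is taken coordinatewise: each coordinate is bounded by the norm,
    and the norm by the sum of the coordinates. *)
Lemma euclid_complete (F : set_system (euclid R n)) :
  ProperFilter F -> cauchy F -> cvg F.
Proof.
move=> FF /cauchy_ballP Fc.
have cF (i : 'I_n) : cvg ((fun v : euclid R n => v 0 i) @ F).
  apply: cauchy_cvg; apply/cauchy_ballP => e e0.
  rewrite near_simpl.
  apply: filterS (Fc e e0) => -[u v] /=.
  rewrite -!ball_normE /= => /(le_lt_trans _); apply.
  by have := coord_le_norm (u - v) i; rewrite !mxE.
pose l : euclid R n := \row_i lim ((fun v : euclid R n => v 0 i) @ F).
apply/cvg_ex; exists l; apply/cvgrPdist_lt => e e0.
have n0 : 0 < n.+1%:R :> R by [].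
have h i : \forall v \near F, `|l 0 i - (v : euclid R n) 0 i| < e / n.+1%:R.
  by rewrite mxE; move/cvgrPdist_lt: (cF i); apply; rewrite divr_gt0.
have {}h := filter_forall _ h.
near=> v.
apply: le_lt_trans (norm_le_sum _) _.
apply: (@le_lt_trans _ _ (\sum_(i < n) e / n.+1%:R)).
  apply: ler_sum => i _; apply: ltW.
  have -> : (l - v) 0 i = l 0 i - v 0 i by rewrite !mxE.
  by apply: (near (h FF)).
rewrite sumr_const card_ord -[ltLHS]mulr_natr -mulrA gtr_pMr // mulrC.
by rewrite ltr_pdivrMr // mul1r ltr_nat.
Unshelve. all: by end_near. Qed.

HB.instance Definition _ :=
  Uniform_isComplete.Build (euclid R n) euclid_complete.

Definition euclid_hilbert : hilbertType R :=
  @Hilbert R (euclid R n) dotp sqr_euclid_normE.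

End Euclid.

(** * Embeddings and inner products *)

Section QE.
Local Open Scope ring_scope.
Variables (R : realType) (G : sgraph).

(** The functions f are the coordinates of the embedding, up to the factor
    sqrt (w / N) for a weight w. *)
Lemma QE_of_sum_squares (N : nat) (s : seq (nat * (G -> int))) : (0 < N)%N ->
  (forall x y : G, N%:Z * (gdist x y)%:Z =
     \sum_(p <- s) p.1%:Z * (p.2 x - p.2 y) ^+ 2) ->
  QE_class R G.
Proof.
move=> N0 Hs; set x0 := (0%N, fun _ : G => 0 : int).
pose w i : R := (nth x0 s i).1%:R / N%:R.
have w0 i : 0 <= w i by rewrite divr_ge0.
pose phi x : euclid R (size s) :=
  \row_i (Num.sqrt (w i) * ((nth x0 s i).2 x)%:~R).
exists (euclid_hilbert R (size s)), phi => x y.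
rewrite [LHS](sqr_euclid_normE (phi x - phi y)) /dotp.
have NR0 : N%:R != 0 :> R by rewrite pnatr_eq0 -lt0n.
apply: (mulfI NR0); rewrite mulr_sumr.
transitivity ((N%:Z * (gdist x y)%:Z)%:~R : R); last by rewrite intrM.
rewrite Hs (big_nth x0) big_mkord rmorph_sum /=; apply: eq_bigr => i _.
rewrite !mxE -mulrBr -expr2 exprMn sqr_sqrtr // mulrA [N%:R * _]mulrC divfK //.
by rewrite intrM rmorphXn /= rmorphB.
Qed.

Variables (H : hilbertType R) (phi : G -> H).
Hypothesis QE : quadratic_embedding phi.

Local Notation "'[ u , v ]" := (inner H u v) (at level 0).

Lemma innerC u v : '[u, v] = '[v, u].
Proof. by rewrite hermC expr0 mul1r. Qed.

Lemma inner_eq0 u : '[u, u] = 0 -> u = 0.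
Proof.
by rewrite -sqr_normE => /eqP; rewrite sqrf_eq0 normr_eq0 => /eqP.
Qed.

(** Polarization: an embedding determines the inner products of differences. *)
Lemma inner_edges p q r s : '[phi p - phi q, phi r - phi s] *+ 2 =
  (gdist p s)%:R + (gdist q r)%:R - (gdist p r)%:R - (gdist q s)%:R.
Proof.
rewrite -!QE !sqr_normE !linearBl !linearBr /=.
rewrite (innerC (phi r) (phi p)) (innerC (phi r) (phi q)).
rewrite (innerC (phi s) (phi p)) (innerC (phi s) (phi q)); ring.
Qed.

End QE.

(** * Distances in a theta graph *)

Lemma has_walk_rev (G : sgraph) (x y : G) n : has_walk x y n -> has_walk y x n.
Proof.
move=> /asboolP[p [xp <- <-]] {y n}; elim: p x xp => [|z p IH] x /=.
  by move=> _; apply/asboolP; exists [::].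
move=> /andP[xz zp]; rewrite -addn1; apply: has_walk_trans (IH _ zp) _.
by apply: has_walk_adj; rewrite adj_sym.
Qed.

(** A function that is attained by walks, and grows by at most 1 along an edge,
    is the distance. *)
Lemma gdist_eq (G : sgraph) (cG : connected_graph G) (D : G -> G -> nat) :
  (forall x y, has_walk x y (D x y)) ->
  (forall x, D x x = 0) ->
  (forall x y z, adj x y -> D x z <= (D y z).+1) ->
  forall x y, gdist x y = D x y.
Proof.
move=> Dw D0 DS x y; have [gw gmin] := gdistP x y cG.
apply/eqP; rewrite eqn_leq gmin //=.
move: gw => /asboolP[p []]; move: (gdist x y) => n {gmin}.
elim: p x n => [|z p IH] x n /=; first by move=> _ -> _; rewrite D0.
move=> /andP[xz zp] lp <-; apply: leq_trans (DS _ _ y xz) _.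
by rewrite ltnS; apply: IH zp lp _.
Qed.

Definition pathA : 'I_3 := @Ordinal 3 0 isT.
Definition pathB : 'I_3 := @Ordinal 3 1 isT.
Definition pathC : 'I_3 := @Ordinal 3 2 isT.

Section ThetaDistance.
Variables (a b c : nat).
Local Notation L := (theta_len a b c).
Local Notation pt k j := (theta_pt a b c k j : theta a b c).

(** The length of the best of the walks through the first endpoint only, the
    second only, both in either order, or staying on the path.  The distance of
    the endpoints is [a], the length of the shortest path. *)
Definition theta_dist (k : 'I_3) (j : nat) (l : 'I_3) (i : nat) : nat :=
  let m := minn (minn (j + i) (L k - j + (L l - i)))
                (minn (j + a + (L l - i)) (L k - j + a + i)) in
  if k == l then minn ((j - i) + (i - j)) m else m.

Lemma theta_distC k j l i : theta_dist k j l i = theta_dist l i k j.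
Proof. by rewrite /theta_dist eq_sym; case: eqP => [->|_]; lia. Qed.

Hypotheses (a0 : 0 < a) (ab : a <= b) (bc : b <= c).

(** A canonical name for each vertex, a right inverse of [theta_pt]. *)
Definition theta_coord (v : theta a b c) : 'I_3 * nat :=
  match v with
  | inl false => (pathA, 0)
  | inl true => (pathA, a)
  | inr (existT k i) => (k, i.+1)
  end.

Lemma theta_lenE : (L pathA = a) * (L pathB = b) * (L pathC = c).
Proof. by []. Qed.

Lemma theta_len_ge k : a <= L k.
Proof.
by rewrite /theta_len (tnth_nth 0); case: k => -[|[|[|//]]] //= _; lia.
Qed.

Lemma theta_pt_last k : pt k (L k) = inl true :> theta a b c.
Proof.
have La := theta_len_ge k; rewrite /theta_pt; case: eqP => [|_]; first by lia.
by rewrite insubF // ltnn.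
Qed.

Lemma theta_pt_mid k j (jk : j < (L k).-1) :
  pt k j.+1 = inr (Tagged (fun k' => 'I_(L k').-1) (Ordinal jk)).
Proof. by rewrite /theta_pt /= insubT. Qed.

Lemma theta_coordP v : (theta_coord v).2 <= L (theta_coord v).1 /\
  pt (theta_coord v).1 (theta_coord v).2 = v.
Proof.
case: v => [[]|[k i]] /=; [|by []|].
  by split; [exact: theta_len_ge|exact: (theta_pt_last pathA)].
by case: i => i ik; rewrite theta_pt_mid; split=> //=; lia.
Qed.

Lemma theta_coord_pt k j : j <= L k ->
  [\/ j = 0 /\ theta_coord (pt k j) = (pathA, 0),
      j = L k /\ theta_coord (pt k j) = (pathA, a) |
      0 < j < L k /\ theta_coord (pt k j) = (k, j)].
Proof.
have La := theta_len_ge k.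
case: j => [|j]; first by constructor 1.
rewrite leq_eqVlt => /orP[/eqP jk|jk].
  by constructor 2; rewrite jk theta_pt_last.
have jk' : j < (L k).-1 by lia.
by constructor 3; rewrite theta_pt_mid /= jk.
Qed.

(** A common endpoint has a name on each path; the formula does not depend on
    the choice. *)
Lemma theta_dist_coord k j l i : j <= L k -> i <= L l ->
  theta_dist (theta_coord (pt k j)).1 (theta_coord (pt k j)).2 l i =
  theta_dist k j l i.
Proof.
move=> jk il; have := theta_len_ge l; have := theta_len_ge k.
have := theta_lenE.1.1.
case: (theta_coord_pt jk) => -[hj ->] //=; rewrite {}hj; rewrite /theta_dist.
  by case: (eqVneq pathA l) => [<-|_]; case: (eqVneq k) => [->|_]; lia.
by case: (eqVneq pathA l) => [<-|_]; case: (eqVneq k) => [->|_]; lia.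
Qed.

Lemma theta_adj_pt k j : j < L k -> @adj (theta a b c) (pt k j) (pt k j.+1).
Proof.
move=> jk; apply/existsP; exists k; apply/existsP; exists (Ordinal jk).
by rewrite eqxx.
Qed.

Lemma theta_walk k j n : j + n <= L k -> has_walk (pt k j) (pt k (j + n)) n.
Proof.
elim: n => [|n IH] h; first by rewrite addn0; apply/asboolP; exists [::].
rewrite -[X in has_walk _ _ X]addn1 addnS; apply: has_walk_trans (IH _) _.
  by lia.
by apply/has_walk_adj/theta_adj_pt; lia.
Qed.

Lemma theta_walk0 k j : j <= L k -> has_walk (pt k j) (inl false) j.
Proof. by move=> jk; apply/has_walk_rev/(@theta_walk k 0 j). Qed.

Lemma theta_walk1 k j : j <= L k -> has_walk (pt k j) (inl true) (L k - j).
Proof.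
by move=> jk; rewrite -(theta_pt_last k) -{1}(subnKC jk); apply: theta_walk; lia.
Qed.

Lemma theta_walk01 : has_walk (inl false : theta a b c) (inl true) a.
Proof. by have := @theta_walk1 pathA 0 isT; rewrite subn0. Qed.

Lemma theta_dist_walk k j l i : j <= L k -> i <= L l ->
  has_walk (pt k j) (pt l i) (theta_dist k j l i).
Proof.
move=> jk il; pose W n := has_walk (pt k j) (pt l i) n.
have Wmin m n : W m -> W n -> W (minn m n) by rewrite /minn; case: ifP.
have w1 : W (j + i).
  exact: has_walk_trans (theta_walk0 jk) (has_walk_rev (theta_walk0 il)).
have w2 : W (L k - j + (L l - i)).
  exact: has_walk_trans (theta_walk1 jk) (has_walk_rev (theta_walk1 il)).
have w3 : W (j + a + (L l - i)).
  apply: has_walk_trans (has_walk_rev (theta_walk1 il)).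
  exact: has_walk_trans (theta_walk0 jk) theta_walk01.
have w4 : W (L k - j + a + i).
  apply: has_walk_trans (has_walk_rev (theta_walk0 il)).
  exact: has_walk_trans (theta_walk1 jk) (has_walk_rev theta_walk01).
have wm := Wmin _ _ (Wmin _ _ w1 w2) (Wmin _ _ w3 w4).
rewrite -/(W _) /theta_dist; case: eqP => // kl; apply: (Wmin) wm.
move: il; rewrite /W -{}kl => ik; have [ij|ji] := leqP i j.
  have -> : j - i + (i - j) = j - i by lia.
  by apply: has_walk_rev; have := @theta_walk k i (j - i); rewrite subnKC //; exact.
have -> : j - i + (i - j) = i - j by lia.
by have := @theta_walk k j (i - j); rewrite subnKC ?(ltnW ji) //; exact.
Qed.

Lemma gdist_theta_coord (x y : theta a b c) :
  gdist x y = theta_dist (theta_coord x).1 (theta_coord x).2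
                         (theta_coord y).1 (theta_coord y).2.
Proof.
pose D x y := theta_dist (theta_coord x).1 (theta_coord x).2
                         (theta_coord y).1 (theta_coord y).2.
rewrite -/(D x y); move: x y.
apply: (gdist_eq (theta_connected a0)).
- move=> x y; have [xL xE] := theta_coordP x; have [yL yE] := theta_coordP y.
  by rewrite -{1}xE -{1}yE; apply: theta_dist_walk.
- by move=> x; rewrite /D /theta_dist eqxx; lia.
move=> x y z /existsP[k /existsP[[j jk]]] /= => h.
rewrite /D; have [] := theta_coordP z; move: (theta_coord z) => [l i] /= il _.
have {h} : (x, y) = (pt k j, pt k j.+1) \/ (y, x) = (pt k j, pt k j.+1).
  by case/orP: h => /eqP; [left|right].
have La := theta_len_ge k.
case=> -[-> ->]; rewrite !theta_dist_coord //; try lia; rewrite /theta_dist.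
  by case: eqP il => [<-|_] il; lia.
by case: eqP il => [<-|_] il; lia.
Qed.

Lemma gdist_pt k j l i : j <= L k -> i <= L l ->
  gdist (pt k j) (pt l i) = theta_dist k j l i.
Proof.
move=> jk il; have [h1 h2] := theta_coordP (pt l i).
rewrite gdist_theta_coord theta_dist_coord // theta_distC.
by rewrite theta_dist_coord // theta_distC.
Qed.

End ThetaDistance.

(** * The Gram matrix of the edges *)

(** The distance of two vertices of a cycle of length [n], as a function of the
    length of one of the arcs between them. *)
Definition tent (n s : nat) : nat := minn s (n - s).

(** Minus the second difference of [tent n] at [s]. *)
Definition tip (n s : nat) : nat :=
  (s.*2.+1 == n) + (s.*2 == n).*2 + (s.*2 == n.+1).

Lemma tent_diff2 n s : 0 < s < n ->
  (tent n s).*2 = tent n s.-1 + tent n s.+1 + tip n s.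
Proof.
rewrite /tip /tent => /andP[s0 sn].
have [h|h|h] := ltngtP s.*2.+1 n; have [h'|h'|h'] := ltngtP s.*2 n;
 have [h2|h2|h2] := ltngtP s.*2 n.+1; rewrite /=; lia.
Qed.

Lemma tip_off n s : (s.*2.+1 < n) || (n.+1 < s.*2) -> tip n s = 0.
Proof. by rewrite /tip; lia. Qed.
Lemma tip_top n s : s.*2 = n -> tip n s = 2.
Proof. by rewrite /tip; lia. Qed.
Lemma tip_near n s : (s.*2.+1 == n) || (s.*2 == n.+1) -> tip n s = 1.
Proof. by rewrite /tip; lia. Qed.

Section Gram.
Variables (a b c : nat).
Hypotheses (a0 : 0 < a) (ab : a <= b) (bc : b <= c).
Local Notation L := (theta_len a b c).
Local Notation pt k j := (theta_pt a b c k j : theta a b c).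
Local Notation dist := (theta_dist a b c).

(** Twice the inner product of edge number [j] of path [k], from vertex [j - 1]
    to vertex [j], with edge number [i] of path [l], in any embedding. *)
Definition theta_gram (k : 'I_3) (j : nat) (l : 'I_3) (i : nat) : int :=
  (dist k j l i.-1 + dist k j.-1 l i)%:Z -
  (dist k j l i + dist k j.-1 l i.-1)%:Z.

Local Notation gram := theta_gram.

(** Path [k] and the shortest path form an isometric cycle. *)
Lemma dist_same k j i : j <= L k -> i <= L k ->
  dist k j k i = tent (a + L k) (j - i + (i - j)).
Proof.
have := theta_len_ge a0 ab bc k; rewrite /theta_dist /tent eqxx.
by move: (L k) => n h1 h2 h3; lia.
Qed.

(** Two paths form a cycle that need not be isometric: the shortest path may be
    a shortcut.  The two disjunctions exclude the corners where it is one. *)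
Lemma dist_across k j l i : k != l -> j <= L k -> i <= L l ->
  (L k <= j.*2 + a) || (i.*2 <= L l + a) ->
  (j.*2 <= L k + a) || (L l <= i.*2 + a) ->
  dist k j l i = tent (L k + L l) (j + i).
Proof.
move=> /negPf kl; rewrite /theta_dist kl /tent.
by move: (L k) (L l) => n m; lia.
Qed.

Lemma gram_same k j i : 0 < j <= L k -> 0 < i <= L k ->
  gram k j k i =
    (((j == i).*2)%:Z - (tip (a + L k) (j - i + (i - j)))%:Z)%R.
Proof.
move=> /andP[j0 jk] /andP[i0 ik].
have aL := theta_len_ge a0 ab bc k; rewrite /theta_gram !dist_same; try lia.
have -> : j.-1 - i.-1 + (i.-1 - j.-1) = j - i + (i - j) by lia.
move: (L k) jk ik aL => n jk ik an.
set d := j - i + (i - j).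
have dn : d < a + n by lia.
have [ji|ji|ji] := ltngtP j i.
- have -> : j - i.-1 + (i.-1 - j) = d.-1 by lia.
  have -> : j.-1 - i + (i - j.-1) = d.+1 by lia.
  have /tent_diff2 : 0 < d < a + n by lia.
  by move: (tent _ _) (tent _ _) (tent _ _) (tip _ _) => x y z t; lia.
- have -> : j - i.-1 + (i.-1 - j) = d.+1 by lia.
  have -> : j.-1 - i + (i - j.-1) = d.-1 by lia.
  have /tent_diff2 : 0 < d < a + n by lia.
  by move: (tent _ _) (tent _ _) (tent _ _) (tip _ _) => x y z t; lia.
have -> : d = 0 by lia.
have -> : j - i.-1 + (i.-1 - j) = 1 by lia.
have -> : j.-1 - i + (i - j.-1) = 1 by lia.
have -> : tent (a + n) 1 = 1 by rewrite /tent; lia.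
have -> : tent (a + n) 0 = 0 by rewrite /tent; lia.
by have -> : tip (a + n) 0 = 0 by rewrite /tip; lia.
Qed.

Lemma gram_across k j l i : k != l -> 0 < j <= L k -> 0 < i <= L l ->
  (L k <= j.-1.*2 + a) || (i.*2 <= L l + a) ->
  (j.*2 <= L k + a) || (L l <= i.-1.*2 + a) ->
  gram k j l i = (tip (L k + L l) (j + i).-1)%:Z%R.
Proof.
move=> kl hj hi h1 h2; rewrite /theta_gram !dist_across //; try lia.
move: (L k) (L l) hj hi h1 h2 => n m hj hi _ _.
have -> : j + i.-1 = (j + i).-1 by lia.
have -> : j.-1 + i = (j + i).-1 by lia.
have -> : j.-1 + i.-1 = (j + i).-1.-1 by lia.
have /tent_diff2 : 0 < (j + i).-1 < n + m by lia.
have -> : (j + i).-1.+1 = j + i by lia.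
by move: (tent _ _) (tent _ _) (tent _ _) (tip _ _) => x y z t; lia.
Qed.

(** Near the first endpoint, a shortest walk from path [k] to another path
    leaves through that endpoint; so the distance splits as a sum of a
    function of [j] and one of [i], and its mixed differences vanish
    ([gram_start]). *)
Lemma dist_start k j l i : k != l -> j.*2 + a <= L k -> i <= L l ->
  dist k j l i = j + minn i (a + L l - i).
Proof.
move=> /negPf kl; have := theta_len_ge a0 ab bc l; rewrite /theta_dist kl.
by move: (L k) (L l) => n m; lia.
Qed.

Lemma dist_end k j l i : k != l -> L k + a <= j.*2 -> j <= L k -> i <= L l ->
  dist k j l i = L k - j + minn (L l - i) (a + i).
Proof.
move=> /negPf kl; have := theta_len_ge a0 ab bc l; rewrite /theta_dist kl.
by move: (L k) (L l) => n m; lia.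
Qed.

Lemma gram_start k j l i : k != l -> 0 < j <= L k -> 0 < i <= L l ->
  j.*2 + a <= L k -> gram k j l i = 0%R.
Proof. by move=> kl hj hi h; rewrite /theta_gram !dist_start //; lia. Qed.

Lemma gram_end k j l i : k != l -> 0 < j <= L k -> 0 < i <= L l ->
  L k + a <= j.-1.*2 -> gram k j l i = 0%R.
Proof. by move=> kl hj hi h; rewrite /theta_gram !dist_end //; lia. Qed.

Lemma gramC k j l i : gram k j l i = gram l i k j.
Proof.
by rewrite /theta_gram (theta_distC _ _ _ l i.-1) (theta_distC _ _ _ l i k j.-1)
  (theta_distC _ _ _ l i) (theta_distC _ _ _ l i.-1) [in RHS]addnC.
Qed.

Lemma gram_diag k j : (0 < j <= L k)%N -> gram k j k j = 2%R.
Proof.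
move=> jk; have := theta_len_ge a0 ab bc k; rewrite gram_same // eqxx subnn => aL.
by rewrite tip_off //; lia.
Qed.

(** In the cycle that it forms with another path, the shortest path is no
    shortcut, so the tent formula holds at all positions. *)
Lemma gram_short k i j : k != pathA -> (0 < i <= a)%N -> (0 < j <= L k)%N ->
  gram pathA i k j = (tip (a + L k) (i + j).-1)%:Z%R.
Proof.
move=> kA hi hj; have aL := theta_len_ge a0 ab bc k.
by rewrite gram_across // 1?eq_sym // !theta_lenE; lia.
Qed.

End Gram.

Section GramPSD.
Local Open Scope ring_scope.
Variables (R : realType) (a b c : nat).
Hypotheses (a0 : (0 < a)%N) (ab : (a <= b)%N) (bc : (b <= c)%N).
Local Notation L := (theta_len a b c).
Local Notation pt k j := (theta_pt a b c k j : theta a b c).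
Hypothesis QE : QE_class R (theta a b c).

Definition is_edge (e : 'I_3 * nat) := (0 < e.2 <= L e.1)%N.
Definition edge_gram (e f : 'I_3 * nat) := theta_gram a b c e.1 e.2 f.1 f.2.

(** The Gram matrix of an embeddable graph is positive semidefinite, and a
    combination of edges of norm 0 is orthogonal to every edge. *)
Lemma gram_psd_radical (s : seq (int * ('I_3 * nat))) :
  all (fun t => is_edge t.2) s ->
  (0 <= \sum_(t <- s) \sum_(u <- s) t.1 * u.1 * edge_gram t.2 u.2) /\
  (\sum_(t <- s) \sum_(u <- s) t.1 * u.1 * edge_gram t.2 u.2 = 0 ->
   forall e, is_edge e -> \sum_(t <- s) t.1 * edge_gram t.2 e = 0).
Proof.
move=> /allP Hs; case: QE => H [phi hphi].
pose ev (e : 'I_3 * nat) : H := phi (pt e.1 e.2) - phi (pt e.1 e.2.-1).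
have evE e f : is_edge e -> is_edge f ->
    inner H (ev e) (ev f) *+ 2 = (edge_gram e f)%:~R.
  move=> /andP[e0 eL] /andP[f0 fL]; rewrite (inner_edges hphi).
  rewrite !(gdist_pt a0) //; try lia.
  rewrite /edge_gram /theta_gram rmorphB /=.
  by rewrite -!pmulrn !natrD opprD addrA.
pose v := \sum_(t <- s) t.1%:~R *: ev t.2.
have vE e : is_edge e ->
    inner H v (ev e) *+ 2 = (\sum_(t <- s) t.1 * edge_gram t.2 e)%:~R.
  move=> He; rewrite linear_sumlz /= -sumrMnl rmorph_sum; apply: eq_big_seq => t ts.
  by rewrite linearZl /= -mulrnAr evE ?Hs // rmorphM.
have vv : inner H v v *+ 2 =
    (\sum_(t <- s) \sum_(u <- s) t.1 * u.1 * edge_gram t.2 u.2)%:~R.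
  rewrite {2}/v linear_sumr /= -sumrMnl exchange_big rmorph_sum.
  apply: eq_big_seq => u us /=.
  rewrite linearZr /= -mulrnAr vE ?Hs // -rmorphM mulr_sumr; congr (_%:~R).
  by apply: eq_bigr => t _; rewrite mulrCA mulrA.
split.
  by rewrite -(ler0z R) -vv mulrn_wge0 // -sqr_normE sqr_ge0.
move=> sv0 e He; apply/eqP; rewrite -(intr_eq0 R) -vE //.
move/eqP: vv; rewrite sv0 mulrn_eq0 /= => /eqP /inner_eq0 ->.
by rewrite linear0l mul0rn.
Qed.

End GramPSD.

(** * Obstructions to an embedding *)

Section NonQE.
Local Open Scope ring_scope.
Variables (R : realType) (a b c : nat).
Hypotheses (a0 : (0 < a)%N) (ab : (a <= b)%N) (bc : (b <= c)%N).
Local Notation L := (theta_len a b c).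
Local Notation gram := (theta_gram a b c).

Hypothesis QE : QE_class R (theta a b c).

(** Unit vectors with inner product 1 are equal. *)
Lemma gram_parallel k j l i m h :
  (0 < j <= L k)%N -> (0 < i <= L l)%N -> (0 < h <= L m)%N ->
  gram k j l i = 2 -> gram k j m h = gram l i m h.
Proof.
move=> hj hi hh g2.
have Hs : all (fun t => is_edge a b c t.2) [:: (1 : int, (k, j)); (-1, (l, i))].
  by rewrite /= /is_edge /= hj hi.
have [_ /(_ _ (m, h) hh)] := gram_psd_radical a0 ab bc QE Hs.
rewrite !big_cons !big_nil /edge_gram /= !gram_diag // (gramC _ _ _ l i k j) g2.
by move=> /(_ erefl); lia.
Qed.

(** The first edge of the shortest path is parallel to an edge of each of the
    other two, but these two edges are orthogonal to each other. *)
Lemma nonQE_even_even :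
  (1 < a)%N -> ~~ odd (a + b) -> ~~ odd (a + c) -> False.
Proof.
move=> a1 eb ec; set n := (a + b)./2; set m := (a + c)./2.
have hn : (0 < n <= L pathB)%N by rewrite theta_lenE; lia.
have hm : (0 < m <= L pathC)%N by rewrite theta_lenE; lia.
have h1 : (0 < 1 <= L pathA)%N by rewrite theta_lenE; lia.
have gAB : gram pathA 1 pathB n = 2.
  by rewrite gram_short // tip_top // theta_lenE; lia.
have gAC : gram pathA 1 pathC m = 2.
  by rewrite gram_short // tip_top // theta_lenE; lia.
have := gram_parallel h1 hn hm gAB; rewrite gAC.
by rewrite gram_across // !theta_lenE ?tip_off //; lia.
Qed.

(** The first edge of the shortest path is parallel to an edge of path [k],
    while their inner products with edge [m] of path [l] are 0 and 1/2. *)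
Lemma nonQE_even_odd k l : k != pathA -> l != pathA -> k != l ->
  (1 < a)%N -> ~~ odd (a + L k) -> odd (a + L l) -> False.
Proof.
move=> kA lA kl a1 ek ol; set n := (a + L k)./2.
have ak := theta_len_ge a0 ab bc k; have al := theta_len_ge a0 ab bc l.
have al' : (a < L l)%N by lia.
set m := ((L l - a).+1)./2.
have hn : (0 < n <= L k)%N by lia.
have hm : (0 < m <= L l)%N by lia.
have h1 : (0 < 1 <= L pathA)%N by rewrite theta_lenE; lia.
have gA : gram pathA 1 k n = 2.
  by rewrite gram_short // tip_top //; lia.
have := gram_parallel h1 hn hm gA.
rewrite gram_short // gram_across //; try lia.
by rewrite tip_off ?tip_near //; lia.
Qed.

(** Number the edges of the second path that are not orthogonal to the shortest
    path by 1, ..., a + 1, and likewise for the third path.  Edges number 2 of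
    the second and number a of the third path are parallel, but their inner
    products with the first edge of the shortest path are 0 and 1/2. *)
Lemma nonQE_odd_odd : (2 < a)%N -> odd (a + b) -> odd (a + c) -> False.
Proof.
move=> a2 ob oc.
set j := ((b - a).+1)./2.+1; set i := (a + (c - a)./2)%N.
have hj : (0 < j <= L pathB)%N by rewrite theta_lenE; lia.
have hi : (0 < i <= L pathC)%N by rewrite theta_lenE; lia.
have h1 : (0 < 1 <= L pathA)%N by rewrite theta_lenE; lia.
have g2 : gram pathB j pathC i = 2.
  by rewrite gram_across // !theta_lenE ?tip_top //; lia.
have := gram_parallel hj hi h1 g2.
rewrite !(gramC _ _ _ _ _ pathA 1) !gram_short // !theta_lenE.
by rewrite tip_off ?tip_near //; lia.
Qed.

End NonQE.

Ltac decide_eqs :=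
  repeat match goal with |- context [@eq_op _ ?x ?y] =>
    first [ have -> : (x == y) = false by lia
          | have -> : (x == y) = true by lia ] end.

Section NonQE_2_odd_odd.
Local Open Scope ring_scope.
Variables (R : realType) (p q : nat).
Hypotheses (p0 : (0 < p)%N) (pq : (p <= q)%N).
Local Notation b := p.*2.+1.
Local Notation c := q.*2.+1.
Local Notation gram := (theta_gram 2 b c).
Local Notation L := (theta_len 2 b c).

Let ab : (2 <= b)%N. Proof. lia. Qed.
Let bc : (b <= c)%N. Proof. lia. Qed.

Lemma tip_odd n s : tip n.*2.+1 s = (s == n) || (s == n.+1).
Proof. by rewrite /tip; lia. Qed.

Lemma gramAA i j : (0 < i <= 2)%N -> (0 < j <= 2)%N ->
  gram pathA i pathA j = (i == j).*2%:Z.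
Proof.
by move=> hi hj; rewrite (gram_same _ ab bc) // !theta_lenE tip_off ?subr0; lia.
Qed.

Lemma gramAk k r i j : L k = r.*2.+1 -> k != pathA ->
  (0 < i <= 2)%N -> (0 < j <= r.*2.+1)%N ->
  gram pathA i k j = ((i + j == r.+2) || (i + j == r.+3))%N%:Z.
Proof.
move=> Lk kA hi hj; rewrite (gram_short _ ab bc) // Lk // (_ : 2 + _ = r.+1.*2.+1)%N //.
by rewrite tip_odd; congr (nat_of_bool _)%:Z; lia.
Qed.

Lemma gramkk k r i j : L k = r.*2.+1 ->
  (0 < i <= r.*2.+1)%N -> (0 < j <= r.*2.+1)%N ->
  gram k i k j = (i == j).*2%:Z -
    ((i - j + (j - i) == r.+1) || (i - j + (j - i) == r.+2))%N%:Z.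
Proof.
move=> Lk hi hj; rewrite (gram_same _ ab bc) ?Lk // (_ : 2 + _ = r.+1.*2.+1)%N //.
by rewrite tip_odd.
Qed.

(** Away from the three middle edges of either path the inner products vanish.
    Edges p and q + 2 are opposite in the cycle made of the two long paths, but
    the shortcut through the shortest path halves their inner product; likewise
    for p + 2 and q. *)
Lemma gramBC j i : (0 < j <= b)%N -> (0 < i <= c)%N ->
  gram pathB j pathC i =
   (((j == p.+1) && (i == q.+1)).*2 + ((j == p) && (i == q.+2))
    + ((j == p.+2) && (i == q)))%N%:Z.
Proof.
move=> hj hi.
have [hs|hs] := leqP j p.-1.
  by rewrite (gram_start _ ab bc) // ?theta_lenE; lia.
have [he|he] := leqP p.+3 j.
  by rewrite (gram_end _ ab bc) // ?theta_lenE; lia.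
have [hs'|hs'] := leqP i q.-1.
  by rewrite gramC (gram_start _ ab bc) // ?theta_lenE; lia.
have [he'|he'] := leqP q.+3 i.
  by rewrite gramC (gram_end _ ab bc) // ?theta_lenE; lia.
have [/andP[/eqP -> /eqP ->]|n1] := boolP ((j == p) && (i == q.+2)).
  rewrite /theta_gram /= (@dist_start _ _ _ _ ab bc pathB p.-1) // ?theta_lenE; try lia.
  rewrite (@dist_start _ _ _ _ ab bc pathB p.-1) // ?theta_lenE; try lia.
  by rewrite !dist_across // !theta_lenE /tent; lia.
have [/andP[/eqP -> /eqP ->]|n2] := boolP ((j == p.+2) && (i == q)).
  rewrite /theta_gram /= (@dist_end _ _ _ _ ab bc pathB p.+2) // ?theta_lenE; try lia.
  rewrite (@dist_end _ _ _ _ ab bc pathB p.+2) // ?theta_lenE; try lia.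
  by rewrite !dist_across // !theta_lenE /tent; lia.
rewrite gram_across // !theta_lenE; try lia.
rewrite (_ : _ + _ = (p + q).+1.*2)%N; last by lia.
by rewrite /tip; decide_eqs; rewrite /=; lia.
Qed.

Hypothesis QE : QE_class R (theta 2 b c).

Ltac eval_gram :=
  rewrite ?(gramC _ _ _ pathB _ pathA) ?(gramC _ _ _ pathC _ pathA);
  rewrite ?(gramC _ _ _ pathC _ pathB);
  repeat match goal with
  | |- context [theta_gram 2 _ _ pathA ?j pathA ?i] => rewrite (@gramAA j i) //
  | |- context [theta_gram 2 _ _ pathA ?j pathB ?i] =>
      rewrite (@gramAk pathB p j i erefl isT); [|by lia..]
  | |- context [theta_gram 2 _ _ pathA ?j pathC ?i] =>
      rewrite (@gramAk pathC q j i erefl isT); [|by lia..]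
  | |- context [theta_gram 2 _ _ pathB ?j pathB ?i] =>
      rewrite (@gramkk pathB p j i erefl); [|by lia..]
  | |- context [theta_gram 2 _ _ pathC ?j pathC ?i] =>
      rewrite (@gramkk pathC q j i erefl); [|by lia..]
  | |- context [theta_gram 2 _ _ pathB ?j pathC ?i] =>
      rewrite (@gramBC j i); [|by lia..]
  end; decide_eqs.

(** Reversal of the three paths acts on the edges.  Up to terms along a_1 - a_2
    the antisymmetric vectors b_(p+2) - b_p and c_(q+2) - c_q are opposite,
    although b_1 is orthogonal to all the edges involved except b_(p+2). *)
Lemma nonQE_long_odd : (1 < p)%N -> False.
Proof.
move=> p1.
pose s : seq (int * ('I_3 * nat)) :=
  [:: (1, (pathB, p.+2)); (-1, (pathB, p)); (1, (pathC, q.+2)); (-1, (pathC, q));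
      (-1, (pathA, 1%N)); (1, (pathA, 2%N))].
have hs : all (fun t => is_edge 2 b c t.2) s.
  by rewrite /s /= /is_edge /= !theta_lenE; lia.
have [_] := @gram_psd_radical R 2 b c isT ab bc QE s hs.
rewrite !big_cons !big_nil /edge_gram /=.
eval_gram; move=> /(_ erefl (pathB, 1%N) isT).
rewrite !big_cons !big_nil /=.
by eval_gram.
Qed.

(** Among the antisymmetric combinations of edges of the third path, the
    differences c_(q+2) - c_q, c_1 - c_(2q+1), c_(q+3) - c_(q-1), ... form a
    chain, where only neighbours have a nonzero inner product.  The coefficients
    6, 4, 2 are such that, given the first, the other two minimize the norm; the
    coefficient 4 of b_3 - b_1 is the even integer nearest to the optimal 18/5,
    and the coefficient -5 of a_1 - a_2 makes the sum orthogonal to a_1 - a_2.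
    Twice the square norm is -4. *)
Lemma nonQE_2_3 : p = 1%N -> (3 < q)%N -> False.
Proof.
move=> p1 q3.
pose s : seq (int * ('I_3 * nat)) :=
  [:: (4, (pathB, 3%N)); (- 4, (pathB, 1%N)); (- 5, (pathA, 1%N)); (5, (pathA, 2%N));
      (6, (pathC, q.+2)); (- 6, (pathC, q)); (4, (pathC, 1%N)); (- 4, (pathC, c));
      (2, (pathC, q.+3)); (- 2, (pathC, q.-1))].
have hs : all (fun t => is_edge 2 b c t.2) s.
  by rewrite /s /= /is_edge /= !theta_lenE; lia.
have [+ _] := @gram_psd_radical R 2 b c isT ab bc QE s hs.
rewrite !big_cons !big_nil /edge_gram /=.
by eval_gram.
Qed.
End NonQE_2_odd_odd.

(** * Two cycles sharing an edge *)

Lemma sum_window n h j i :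
  \sum_(s <- iota 1 n) ((s <= j) && (i < s + h)) = minn n j - (i - h).
Proof.
elim: n => [|n IH]; first by rewrite big_nil min0n.
rewrite -[n.+1]addn1 iotaD big_cat big_seq1 IH /=; lia.
Qed.

Lemma sqr_bool_sub (x y : bool) :
  ((x%:Z - y%:Z) ^+ 2 = (x + y)%:Z - (x && y).*2%:Z)%R.
Proof. by case: x y => -[]. Qed.

Definition window (s h j : nat) : bool := (s <= j) && (j < s + h).

Lemma sum_window_diff n h j i : j <= i ->
  (\sum_(s <- iota 1 n) ((window s h j)%:Z - (window s h i)%:Z) ^+ 2 =
  ((minn n j - (j - h)) + (minn n i - (i - h)))%N%:Z -
   (minn n j - (i - h)).*2%:Z)%R.
Proof.
move=> ji; under eq_bigr do rewrite sqr_bool_sub.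
rewrite sumrB -2!rmorph_sum /= big_split /= /window !sum_window.
congr (_ - _%:Z)%R; rewrite -sum_window -!muln2 big_distrl /=.
by apply: eq_bigr => s _; rewrite muln2; congr (nat_of_bool _).*2; lia.
Qed.

(** A cycle with vertices 0, ..., L has L + 1 cuts into an arc of (L + 1) / 2
    vertices, rounded down, and its complement.  Two of them separate 0 from L;
    the others are represented by the side that avoids 0 and L, whence the two
    lengths of windows. *)
Definition cycle_cuts (L j i : nat) : int :=
 (\sum_(s <- iota 1 L./2)
     ((window s (uphalf L) j)%:Z - (window s (uphalf L) i)%:Z) ^+ 2 +
  \sum_(s <- iota 1 (uphalf L).-1)
     ((window s L./2.+1 j)%:Z - (window s L./2.+1 i)%:Z) ^+ 2)%R.

Lemma cycle_cutsC L j i : cycle_cuts L j i = cycle_cuts L i j.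
Proof. by congr (_ + _)%R; apply: eq_bigr => s _; rewrite -sqrrN opprB. Qed.

Ltac resolve_min :=
  repeat match goal with |- context [minn ?x ?y] =>
    first [ rewrite (_ : minn x y = x); [|by lia]
          | rewrite (_ : minn x y = y); [|by lia] ] end.

(** Twice the distance in the cycle counts all the cuts; those through the edge
    from L to 0 split the vertices at the middle, and differ in the side of the
    middle vertex, if there is one. *)
Lemma cycle_cutsE L j i : 0 < L -> j <= L -> i <= L ->
  (cycle_cuts L j i = (tent L.+1 (j - i + (i - j))).*2%:Z -
   (((j.*2 < L) != (i.*2 < L)) + ((j.*2 <= L) != (i.*2 <= L)))%N%:Z)%R.
Proof.
move=> L0; wlog ji : j i / j <= i.
  move=> H jL iL; case/orP: (leq_total j i) => h; first exact: H.
  by rewrite cycle_cutsC H // addnC (eq_sym (j.*2 < L)) (eq_sym (j.*2 <= L)).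
move=> _ iL; rewrite /cycle_cuts !sum_window_diff // /tent.
have {L0} -> : (j - i + (i - j)) = i - j by lia.
rewrite uphalf_half; have := odd_double_half L.
case: (odd L); move: (L./2) => m /= hL; subst L; rewrite /= in iL *.
  have h x : ((x.*2 < 1 + m.*2) = (x <= m)) * ((x.*2 <= 1 + m.*2) = (x <= m)).
    by split; lia.
  rewrite !h.
  have [hj|hj] := leqP j m; have [hi|hi] := leqP i m; rewrite /= ?addn0 ?subr0;
  have [d|d] := leqP (i - j) m; resolve_min; lia.
have h x : ((x.*2 < 0 + m.*2) = (x < m)) * ((x.*2 <= 0 + m.*2) = (x <= m)).
  by split; lia.
rewrite !h.
have [hj|hj|hj] := ltngtP j m; have [hi|hi|hi] := ltngtP i m; rewrite /= ?addn0 ?subr0;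
  have [d|d] := leqP (i - j) m; resolve_min; lia.
Qed.

Section Chord.
Variables (R : realType) (b c : nat).
Hypotheses (b1 : 1 <= b) (bc : b <= c).
Local Notation L := (theta_len 1 b c).
Local Notation V := (theta 1 b c).

(** The vertices of the other paths are sent to 0, because they lie on the same
    side as the endpoints for all the cuts in [cycle_cuts]. *)
Definition on_path (m : 'I_3) (v : V) : nat :=
  if (theta_coord v).1 == m then (theta_coord v).2 else 0.

(** The two cuts through the common edge; each of them separates the middle
    vertex of an odd cycle from one end of that edge.  If both cycles are odd,
    the other cuts only account for 2d - 2 between the two middle vertices, at
    distance d, so both of these cuts must separate them: the third path puts
    its middle vertex on the opposite side. *)
Definition half1 (k : 'I_3) (j : nat) : bool :=
  if k == pathC then j.*2 <= L k else j.*2 < L k.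
Definition half2 (k : 'I_3) (j : nat) : bool :=
  if k == pathC then j.*2 < L k else j.*2 <= L k.

Definition half_cut (h : 'I_3 -> nat -> bool) (v : V) : int :=
  (h (theta_coord v).1 (theta_coord v).2)%:Z%R.

Definition path_cuts (m : 'I_3) : seq (nat * (V -> int)) :=
  [seq (1, fun v => (window s (uphalf (L m)) (on_path m v))%:Z%R)
    | s <- iota 1 (L m)./2] ++
  [seq (1, fun v => (window s (L m)./2.+1 (on_path m v))%:Z%R)
    | s <- iota 1 (uphalf (L m)).-1].

Lemma sum_path_cuts m x y :
  (\sum_(p <- path_cuts m) p.1%:Z * (p.2 x - p.2 y) ^+ 2 =
   cycle_cuts (L m) (on_path m x) (on_path m y))%R.
Proof.
rewrite big_cat /= !big_map; congr (_ + _)%R; apply: eq_bigr => s _ /=;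
  by rewrite mul1r.
Qed.

Lemma cycle_cuts0 l : 0 < l -> cycle_cuts l 0 0 = 0%R.
Proof. by move=> l0; rewrite cycle_cutsE // !eqxx. Qed.

Lemma double_chord_dist_same k j i : 0 < L k -> j <= L k -> i <= L k ->
  (2 * (theta_dist 1 b c k j k i)%:Z =
   ((half1 k j)%:Z - (half1 k i)%:Z) ^+ 2 +
   ((half2 k j)%:Z - (half2 k i)%:Z) ^+ 2 +
   cycle_cuts (L k) j i)%R.
Proof.
move=> L0 jk ik; rewrite (dist_same _ b1 bc) // cycle_cutsE // add1n !sqr_bool_sub.
rewrite /half1 /half2; move: (tent _ _) => t.
case: (k == pathC); case: (_ < L k); case: (_ < L k); case: (_ <= L k);
 case: (_ <= L k) => /=; lia.
Qed.

Lemma double_chord_dist_across k j l i : k != l -> j <= L k -> i <= L l ->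
  (2 * (theta_dist 1 b c k j l i)%:Z =
   ((half1 k j)%:Z - (half1 l i)%:Z) ^+ 2 +
   ((half2 k j)%:Z - (half2 l i)%:Z) ^+ 2 +
   (cycle_cuts (L k) j 0 + cycle_cuts (L l) 0 i))%R.
Proof.
move=> kl jk il; have a1 : 0 < 1 by [].
have := theta_len_ge a1 b1 bc l; have := theta_len_ge a1 b1 bc k => Lk Ll.
(* The first path has length 1, hence no middle vertex. *)
have notC : k != pathC -> l != pathC -> L k = 1 \/ L l = 1.
  by move: k l kl {jk il Lk Ll} => [[|[|[|//]]] ?] [[|[|[|//]]] ?] //=; auto.
have : (k == pathC) && (l == pathC) = false.
  by apply/negP => /andP[/eqP kC /eqP lC]; rewrite kC lC eqxx in kl.
rewrite !cycle_cutsE // /theta_dist (negPf kl) /tent sub0n subn0 addn0.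
rewrite !sqr_bool_sub /half1 /half2.
move: (L k) (L l) notC jk il Lk Ll => m n notC jk il Lk Ll; rewrite Lk Ll leq0n.
case: (k == pathC) notC; case: (l == pathC) => //= notC _;
have [hj|hj|hj] := ltngtP j.*2 m; have [hi|hi|hi] := ltngtP i.*2 n => /=;
 resolve_min; lia.
Qed.

Lemma QE_chord : QE_class R (theta 1 b c).
Proof.
have a1 : 0 < 1 by [].
apply: (@QE_of_sum_squares R V 2 [:: (1, half_cut half1),
   (1, half_cut half2) & flatten [seq path_cuts m | m : 'I_3]]) => // x y.
rewrite !big_cons big_flatten big_map big_enum /=.
under eq_bigr do rewrite sum_path_cuts.
rewrite !mul1r (gdist_theta_coord a1 b1 bc) // /on_path /half_cut.
case: (theta_coordP a1 b1 bc x) (theta_coordP a1 b1 bc y) => + _ [+ _].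
move: (theta_coord x) (theta_coord y) => [k j] [l i] /= jk il.
have L0 m : 0 < L m := theta_len_ge a1 b1 bc m.
have [kl|kl] := eqVneq k l.
  move: il; rewrite -{}kl => il.
  rewrite double_chord_dist_same // [RHS]addrA; congr (_ + _)%R.
  rewrite (bigD1 k) //= eqxx big1 ?addr0 // => m /negPf mk.
  by rewrite eq_sym mk cycle_cuts0.
rewrite double_chord_dist_across // [RHS]addrA; congr (_ + _)%R.
have lk : (l == k) = false by rewrite eq_sym (negPf kl).
rewrite (bigD1 k) //= (bigD1 l) ?lk //= !eqxx (negPf kl) ?lk.
rewrite big1 ?addr0 // => m /andP[/negPf mk /negPf ml].
by rewrite ![_ == m]eq_sym mk ml cycle_cuts0.
Qed.
End Chord.

(** * The three sporadic graphs *)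

Section Table.
Variables (R : realType) (a b c : nat).
Hypotheses (a0 : 0 < a) (ab : a <= b) (bc : b <= c).
Local Notation L := (theta_len a b c).

(** A table lists the values of a function along each of the three paths, both
    endpoints included. *)
Definition entry (t : seq (seq nat)) (k : 'I_3) (j : nat) : nat :=
  nth 0 (nth [::] t k) j.

Definition table_sum (T : seq (nat * seq (seq nat))) k j l i : nat :=
  sumn [seq p.1 * ((entry p.2 k j - entry p.2 l i)
                   + (entry p.2 l i - entry p.2 k j)) ^ 2 | p <- T].

Definition table_ok (N : nat) (T : seq (nat * seq (seq nat))) : bool :=
  let paths := [:: pathA; pathB; pathC] in
  all (fun k => all (fun l =>
    all (fun j => all (fun i =>
      N * theta_dist a b c k j l i == table_sum T k j l i)
      (iota 0 (L l).+1)) (iota 0 (L k).+1)) paths) paths.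

Lemma QE_of_table N T : 0 < N -> table_ok N T -> QE_class R (theta a b c).
Proof.
move=> N0 ok.
pose f (t : seq (seq nat)) (v : theta a b c) : int :=
  (entry t (theta_coord v).1 (theta_coord v).2)%:Z%R.
apply: (@QE_of_sum_squares R _ N [seq (p.1, f p.2) | p <- T]) => // x y.
rewrite (gdist_theta_coord a0 ab bc) big_map /= -PoszM.
case: (theta_coordP a0 ab bc x) (theta_coordP a0 ab bc y) => + _ [+ _].
rewrite /f; move: (theta_coord x) (theta_coord y) => [k j] [l i] /= jk il.
have path_mem m : m \in [:: pathA; pathB; pathC].
  by case: m => -[|[|[|//]]] ?.
have /allP/(_ l (path_mem l)) := allP ok k (path_mem k).
move=> /allP/(_ j); rewrite mem_iota add0n ltnS => /(_ jk).
move=> /allP/(_ i); rewrite mem_iota add0n ltnS => /(_ il) /eqP ->.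
rewrite /table_sum sumnE big_map rmorph_sum; apply: eq_bigr => p _ /=.
rewrite PoszM; congr (_ * _)%R.
by case: (leqP (entry p.2 k j) (entry p.2 l i)) => h; rewrite !expr2; nia.
Qed.
End Table.

(** The tables come from an LDL^T decomposition of the Gram matrix of the
    vertices, taken in an order that keeps the integers small. *)
Lemma QE_2_3_3 (R : realType) : QE_class R (theta 2 3 3).
Proof.
by apply: (@QE_of_table R 2 3 3 _ _ _ 4
  [:: (1, [:: [:: 0; 1; 2]; [:: 0; 0; 2; 2]; [:: 0; 0; 2; 2]]);
      (2, [:: [:: 1; 1; 1]; [:: 1; 0; 0; 1]; [:: 1; 2; 2; 1]]);
      (2, [:: [:: 1; 1; 0]; [:: 1; 0; 0; 0]; [:: 1; 0; 0; 0]]);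
      (2, [:: [:: 0; 1; 1]; [:: 0; 0; 0; 1]; [:: 0; 0; 0; 1]]);
      (1, [:: [:: 0; 1; 0]; [:: 0; 0; 0; 0]; [:: 0; 0; 0; 0]])]).
Qed.

Lemma QE_2_3_5 (R : realType) : QE_class R (theta 2 3 5).
Proof.
by apply: (@QE_of_table R 2 3 5 _ _ _ 8
  [:: (2, [:: [:: 1; 0; 0]; [:: 1; 2; 2; 0]; [:: 1; 1; 0; 0; 0; 0]]);
      (2, [:: [:: 0; 0; 0]; [:: 0; 0; 0; 0]; [:: 0; 1; 2; 2; 2; 0]]);
      (2, [:: [:: 2; 2; 0]; [:: 2; 1; 0; 0]; [:: 2; 2; 1; 0; 0; 0]]);
      (2, [:: [:: 1; 0; 0]; [:: 1; 0; 0; 0]; [:: 1; 2; 2; 2; 0; 0]]);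
      (1, [:: [:: 1; 0; 0]; [:: 1; 2; 0; 0]; [:: 1; 2; 2; 0; 0; 0]]);
      (2, [:: [:: 1; 0; 0]; [:: 1; 1; 0; 0]; [:: 1; 0; 1; 0; 0; 0]]);
      (1, [:: [:: 1; 0; 0]; [:: 1; 0; 0; 0]; [:: 1; 0; 0; 0; 0; 0]])]).
Qed.

Lemma QE_2_3_7 (R : realType) : QE_class R (theta 2 3 7).
Proof.
by apply: (@QE_of_table R 2 3 7 _ _ _ 8
  [:: (2, [:: [:: 0; 0; 1]; [:: 0; 2; 2; 1]; [:: 0; 0; 0; 0; 0; 1; 1; 1]]);
      (2, [:: [:: 0; 0; 0]; [:: 0; 0; 0; 0]; [:: 0; 2; 2; 2; 2; 1; 0; 0]]);
      (2, [:: [:: 0; 0; 0]; [:: 0; 0; 0; 0]; [:: 0; 0; 2; 2; 2; 2; 1; 0]]);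
      (2, [:: [:: 0; 1; 2]; [:: 0; 0; 2; 2]; [:: 0; 0; 0; 0; 2; 2; 2; 2]]);
      (2, [:: [:: 0; 0; 1]; [:: 0; 0; 0; 1]; [:: 0; 0; 0; 2; 2; 2; 2; 1]]);
      (1, [:: [:: 0; 2; 1]; [:: 0; 0; 0; 1]; [:: 0; 0; 0; 0; 0; 2; 1; 1]]);
      (2, [:: [:: 0; 1; 1]; [:: 0; 0; 0; 1]; [:: 0; 0; 0; 0; 0; 0; 1; 1]]);
      (1, [:: [:: 1; 1; 0]; [:: 1; 1; 1; 0]; [:: 1; 1; 1; 1; 1; 1; 2; 0]])]).
Qed.

Theorem theorem1 (R : realType) (alpha beta gamma : nat)
    (h1 : 1 <= alpha) (hab : alpha <= beta) (hbg : beta <= gamma)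
    (hb : 2 <= beta) :
  QE_class R (theta alpha beta gamma) <->
  (alpha = 1 \/
   [/\ alpha = 2, beta = 3 & gamma \in [:: 3; 5; 7]]).
Proof.
split=> [QE|[->|[-> -> gam]]]; last 2 first.
- by apply: QE_chord; lia.
- move: gam; rewrite !inE => /or3P[] /eqP ->;
  [exact: QE_2_3_3|exact: QE_2_3_5|exact: QE_2_3_7].
have [|a1] := leqP alpha 1; first by left; lia.
have [ob|eb] := boolP (odd (alpha + beta));
  have [oc|ec] := boolP (odd (alpha + gamma)).
- have [a2|a2] := ltnP 2 alpha; first by case: (nonQE_odd_odd h1 hab hbg QE).
  have {a1 a2 h1} aE : alpha = 2 by lia.
  subst alpha; right; have [p bE] : exists p, beta = p.*2.+1 by exists beta./2; lia.
  have [q cE] : exists q, gamma = q.*2.+1 by exists gamma./2; lia.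
  subst beta gamma; have p0 : 0 < p by lia.
  have pq : p <= q by lia.
  have [p1|p1] := ltnP 1 p; first by case: (nonQE_long_odd p0 pq QE).
  have pE : p = 1 by lia.
  have [q3|q3] := ltnP 3 q; first by case: (nonQE_2_3 p0 pq QE).
  by split; rewrite ?inE; lia.
- by case: (nonQE_even_odd h1 hab hbg QE (k := pathC) (l := pathB)).
- by case: (nonQE_even_odd h1 hab hbg QE (k := pathB) (l := pathC)).
by case: (nonQE_even_even h1 hab hbg QE).
Qed.
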